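(* Let $d \ge 3$ be an integer, and let $m$ be a product of $r \ge 2$ distinct primes. Then every symmetric Boolean function on $n$ bits can be computed by a depth-$d$ $\text{MOD}_m$ circuit of size $\exp(\tilde{O}(n^{1/(r+d-3)}))$.
   Context: A Boolean function $f:\{0,1\}^n\to\{0,1\}$ is symmetric if $f(\mathbf{x})$ depends only on the number of ones in $\mathbf{x}$. A $\text{MOD}_m$ gate has unbounded fan-in and outputs $1$ iff the sum of its Boolean inputs (counted with multiplicity of wires) is divisible by $m$. A $\text{MOD}_m$ circuit is a circuit all of whose gates are $\text{MOD}_{m'}$ gates with $m' \mid m$ (equivalently, up to wire multiplicities, $\text{MOD}_m$ gates) over the input variables (and constants). Size is the number of gates. $\tilde{O}(\cdot)$ hides polylogarithmic factors in $n$; constants may depend on $d$ and $m$, with $n\to\infty$. *)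

(* Defs.v *)
From HB Require Import structures.
From mathcomp Require Import all_boot all_order all_algebra.
From mathcomp Require Import all_classical all_reals all_analysis.
Set Implicit Arguments.
Unset Strict Implicit.
Unset Printing Implicit Defensive.
Import Order.TTheory GRing.Theory Num.Theory.
Import numFieldNormedType.Exports.

Local Open Scope nat_scope.

Definition symmetric_function (n : nat) (f : n.-tuple bool -> bool) : Prop :=
  forall x y : n.-tuple bool, count id x = count id y -> f x = f y.

Inductive wire (n : nat) : Type :=
  | Const of bool
  | Var of 'I_n
  | Gate of nat.
Arguments Const {n} _.
Arguments Gate {n} _.

(* A wire that occurs several times in [fanin] counts with multiplicity. *)
Record mod_gate (n : nat) : Type := ModGate {
  modulus : nat;
  fanin : seq (wire n)
}.

Definition wire_before (n k : nat) (w : wire n) : bool :=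
  if w is Gate j then j < k else true.

(* [gs] lists gates number k, k+1, ...; acyclicity of the circuit is expressed
   by requiring each gate to read only gates of smaller number. *)
Fixpoint topological (n k : nat) (gs : seq (mod_gate n)) : bool :=
  if gs is g :: gs' then all (wire_before k) (fanin g) && topological k.+1 gs'
  else true.

(* Gates are shared (a circuit is a DAG); the last gate is the output. *)
Record circuit (n : nat) : Type := Circuit {
  gates : seq (mod_gate n);
  gates_nonempty : 0 < size gates;
  gates_topological : topological 0 gates
}.

Definition wire_val (n : nat) (x : n.-tuple bool) (vs : seq bool)
    (w : wire n) : bool :=
  match w with
  | Const b => b
  | Var i => tnth x i
  | Gate j => nth false vs j
  end.

Definition gate_val (n : nat) (x : n.-tuple bool) (vs : seq bool)
    (g : mod_gate n) : bool :=
  modulus g %| \sum_(w <- fanin g) wire_val x vs w.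

Definition gate_vals (n : nat) (x : n.-tuple bool) (gs : seq (mod_gate n)) :
    seq bool :=
  foldl (fun vs g => rcons vs (gate_val x vs g)) [::] gs.

Definition circuit_eval (n : nat) (c : circuit n) (x : n.-tuple bool) : bool :=
  last false (gate_vals x (gates c)).

Definition computes (n : nat) (c : circuit n) (f : n.-tuple bool -> bool) :
    Prop :=
  forall x : n.-tuple bool, circuit_eval c x = f x.

Definition circuit_size (n : nat) (c : circuit n) : nat := size (gates c).

Definition wire_depth (n : nat) (ds : seq nat) (w : wire n) : nat :=
  if w is Gate j then nth 0 ds j else 0.

Definition gate_depths (n : nat) (gs : seq (mod_gate n)) : seq nat :=
  foldl (fun ds g =>
    rcons ds (\max_(w <- fanin g) wire_depth ds w).+1) [::] gs.

(* The largest number of gates on a path; variables and constants have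
   depth 0. *)
Definition circuit_depth (n : nat) (c : circuit n) : nat :=
  \max_(k <- gate_depths (gates c)) k.

Definition is_mod_circuit (n m : nat) (c : circuit n) : bool :=
  all (fun g => modulus g %| m) (gates c).

Local Open Scope classical_set_scope.
Local Open Scope ring_scope.

(* u = ~O(g): O(g) up to a fixed power of log n, as n tends to infinity. *)
Definition soft_bigO (R : realType) (u g : nat -> R) : Prop :=
  exists k : nat, u =O_\oo (fun n : nat => g n * ln n%:R ^+ k).

(* Main.v *)
(* For a prime power p^e the condition "the number N of ones is c mod p^e" is a
   polynomial of degree < p^e over F_p in the input bits. Taking p^e of order t for
   each of the r primes, the Chinese remainder theorem decides N = c for blocks of
   up to t^r bits. Conjunctions are converted from one prime to another: for
   z = 1 - y with 0/1 entries, the number of a in F_p^k with a.z = 0 minus the number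
   of those with a.z = 1 is p^k if z = 0 and 0 otherwise, and p^k is invertible modulo
   q. So a conjunction of k sums modulo p of gates is a sum modulo q of about p^k MOD_p
   gates, one level higher. This gives the monomials at level 1 and N = c at level 2.
   If N = c is available as a sum of gates at some level for blocks of T bits, then for
   t T bits one sums, over all guesses of the t block counts with the right total, the
   conjunctions of the block tests: one more level multiplies the block size by t.
   After one output gate, depth d handles t^(r+d-3) bits with size exp(O(t log n)). *)
Require Import Defs.
From HB Require Import structures.
From mathcomp Require Import all_boot all_order all_algebra.
From mathcomp Require Import all_classical all_reals all_analysis.
From mathcomp Require Import zify ring.
Import Order.TTheory GRing.Theory Num.Theory.
Import numFieldNormedType.Exports.

Set Implicit Arguments.
Unset Strict Implicit.
Unset Printing Implicit Defensive.

Local Open Scope nat_scope.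

(** * Arithmetic *)

Lemma dvdn_bin_primeX (p e j : nat) :
  prime p -> 0 < j < p ^ e -> p %| 'C(p ^ e, j).
Proof.
move=> p_pr /andP[j_gt0 lt_j]; apply: contraLR lt_j => ndvd.
rewrite -leqNgt dvdn_leq //.
(* By absorption p^e divides j C(p^e, j); coprimality then moves the divisibility onto j. *)
have co : coprime (p ^ e) 'C(p ^ e, j) by rewrite coprimeXl // prime_coprime.
have K_gt0 : 0 < p ^ e by rewrite expn_gt0 prime_gt0.
rewrite -(Gauss_dvdl _ co) -[j in j * _](prednK j_gt0) -[j in 'C(_, j)](prednK j_gt0).
by rewrite -mul_bin_diag dvdn_mulr.
Qed.

(** In the Vandermonde expansion of C(p^e + M, k), every term but the first carries a factor C(p^e,
    j) with 0 < j < p^e, which vanishes modulo p. *)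
Lemma bin_periodic_modp (p e M k : nat) :
  prime p -> k < p ^ e -> 'C(p ^ e + M, k) = 'C(M, k) %[mod p].
Proof.
move=> p_pr lt_k; rewrite -binomial.Vandermonde big_ord_recl bin0 mul1n subn0 /=.
rewrite -modnDmr; set s := (X in _ + X %% _).
suff /eqP -> : p %| s by rewrite addn0.
apply: dvdn_sum => i _; rewrite dvdn_mulr // dvdn_bin_primeX //.
by rewrite /= (leq_ltn_trans _ lt_k) // /bump /= add1n.
Qed.

(** Periodicity reduces to M < p^e, where the binomial is 0 except at M = p^e - 1. *)
Lemma bin_primeX_pred (p e M : nat) : prime p ->
  'C(M, (p ^ e).-1) = (p ^ e %| M.+1) %[mod p].
Proof.
move=> p_pr; have K_gt0 : 0 < p ^ e by rewrite expn_gt0 prime_gt0.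
have [n] := ubnP M; elim: n M => // n IHn M le_Mn.
have [lt_M|le_M] := ltnP M (p ^ e); last first.
  rewrite -(subnKC le_M) bin_periodic_modp ?prednK //.
  rewrite -addnS dvdn_addr // IHn //; lia.
have [eq_M|ne_M] := eqVneq M.+1 (p ^ e).
  by rewrite -eq_M binn dvdnn.
rewrite bin_small; last by lia.
by rewrite [_ %| _]negbTE //; apply/negP => /(dvdn_leq (ltn0Sn _)); lia.
Qed.

(* [C(N + s, p^e - 1)] with [s = p^e - 1 - c] is the indicator of [N = c mod p^e];
   Vandermonde expands it into the [C(N, j)], i.e. sums of monomials in the bits. *)
Lemma indicator_modX_bin (p e N c : nat) : prime p ->
  \sum_(j < p ^ e) ('C((p ^ e).-1 - c %% p ^ e, (p ^ e).-1 - j) %% p) * 'C(N, j)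
    = (N == c %[mod p ^ e]) %[mod p].
Proof.
move=> p_pr; have K_gt0 : 0 < p ^ e by rewrite expn_gt0 prime_gt0.
set K := p ^ e in K_gt0 *; set s := K.-1 - c %% K.
have -> : (N == c %[mod K]) = (K %| (N + s).+1).
  have lt_c := ltn_pmod c K_gt0.
  have -> : (N + s).+1 = N + (K - c %% K) by rewrite /s; lia.
  rewrite -(modn_mod c) -(eqn_modDr (K - c %% K)) subnKC; last exact: ltnW.
  by rewrite modnn modn_mod.
rewrite -bin_primeX_pred // -/K -binomial.Vandermonde.
rewrite -(big_mkord xpredT (fun j => 'C(s, K.-1 - j) %% p * 'C(N, j))).
rewrite -[in index_iota 0 K](prednK K_gt0) big_mkord.
elim/big_rec2: _ => // i u v _ e_uv.
by rewrite -modnDmr e_uv modnDmr -modnDml modnMml modnDml mulnC.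
Qed.

(** * Chinese remaindering over distinct primes *)

Lemma coprime_prod_seq (I : eqType) (s : seq I) (F : I -> nat) (k : nat) :
  {in s, forall i, coprime k (F i)} -> coprime k (\prod_(i <- s) F i).
Proof.
move=> co_F; rewrite big_seq; elim/big_rec: _ => [|i x i_s co_x].
  exact: coprimen1.
by rewrite coprimeMr co_F.
Qed.

Lemma coprime_prod_div (p : nat) (ps : seq nat) :
  all prime ps -> uniq ps -> p \in ps -> coprime p ((\prod_(q <- ps) q) %/ p).
Proof.
move=> ps_pr ps_uniq p_ps; have p_pr := allP ps_pr _ p_ps.
rewrite (big_rem p) //= mulKn ?prime_gt0 //.
apply: coprime_prod_seq => q q_in; rewrite prime_coprime //.
rewrite dvdn_prime2 ?(allP ps_pr _ (mem_rem q_in)) //.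
by apply: contraTneq q_in => <-; rewrite mem_rem_uniqF.
Qed.

(** The cofactor m / q is prime to q and divisible by every other prime, so modulo q only the term
    of q survives. *)
Lemma dvdn_crt_sum (ps : seq nat) (g : nat -> nat) :
  all prime ps -> uniq ps ->
  (\prod_(q <- ps) q %| \sum_(q <- ps) (\prod_(p <- ps) p) %/ q * g q)
    = all (fun q => q %| g q) ps.
Proof.
move=> ps_pr ps_uniq; set m := \prod_(q <- ps) q.
have dvd_m q : q \in ps -> q %| m by move=> q_ps; rewrite /m (big_rem q) ?dvdn_mulr.
apply/idP/allP => [m_dvd q q_ps | dvd_g]; last first.
  rewrite big_seq; apply: dvdn_sum => q q_ps.
  rewrite -{1}(divnK (dvd_m _ q_ps)) dvdn_pmul2l ?dvd_g // divn_gt0 ?prime_gt0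
    ?(allP ps_pr) // dvdn_leq ?dvd_m // /m big_seq prodn_cond_gt0 // => i.
  by move/(allP ps_pr)/prime_gt0.
have := dvdn_trans (dvd_m _ q_ps) m_dvd; rewrite (big_rem q) //= dvdn_addl.
  by rewrite Gauss_dvdr // coprime_prod_div.
rewrite big_seq; apply: dvdn_sum => p p_in; apply: dvdn_mulr.
have p_ps := mem_rem p_in.
have [q_pr p_pr] : prime q /\ prime p by rewrite !(allP ps_pr).
rewrite -(@Gauss_dvdr _ p) ?[p * _]mulnC ?divnK ?dvd_m // prime_coprime // dvdn_prime2 //.
by apply: contraTneq p_in => <-; rewrite mem_rem_uniqF.
Qed.

Lemma eq_of_prime_powers (ps : seq nat) (e : nat -> nat) (N c : nat) :
  all prime ps -> uniq ps ->
  N < \prod_(q <- ps) q ^ e q -> c < \prod_(q <- ps) q ^ e q ->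
  all (fun q => N == c %[mod q ^ e q]) ps = (N == c).
Proof.
move=> ps_pr ps_uniq lt_N lt_c; apply/idP/eqP => [|->]; last exact/allP.
suff: all (fun q => N == c %[mod q ^ e q]) ps -> N == c %[mod \prod_(q <- ps) q ^ e q].
  by rewrite !modn_small // => eq_Nc /eq_Nc/eqP.
elim: ps ps_pr ps_uniq {lt_N lt_c} => [|q ps IHps] /=.
  by rewrite big_nil !modn1.
case/andP=> q_pr ps_pr /andP[q_ps ps_uniq] /andP[eq_q /(IHps ps_pr ps_uniq) eq_ps].
rewrite big_cons chinese_remainder ?eq_q //.
rewrite coprimeXl //; apply: coprime_prod_seq => p p_ps.
rewrite coprimeXr // prime_coprime // dvdn_prime2 ?(allP ps_pr p p_ps) //.
by apply: contraNneq q_ps => ->.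
Qed.

Lemma ltn_expn_prod (ps : seq nat) (e : nat -> nat) (t : nat) :
  ps != [::] -> (forall q, q \in ps -> t < q ^ e q) ->
  t ^ size ps < \prod_(q <- ps) q ^ e q.
Proof.
elim: ps => // q [|p ps] IHps _ lt_t.
  by rewrite big_seq1 expn1 lt_t ?mem_head.
rewrite big_cons expnS; apply: ltn_mul; first by rewrite lt_t ?mem_head.
by apply: IHps => // u u_in; rewrite lt_t // inE u_in orbT.
Qed.

(** * Trees of modular gates *)

(* Circuits without sharing, of depth exactly [l] and fan-in at most [W]. As the
   depth is a constant, unsharing costs only a constant factor in the exponent
   of the size. *)
Fixpoint modtree (n m W l : nat) (F : n.-tuple bool -> bool) : Prop :=
  if l is l'.+1 then
    exists q (fs : seq {ffun n.-tuple bool -> bool}),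
      [/\ q %| m, size fs <= W, (forall G, G \in fs -> modtree m W l' G) &
          forall x, F x = (q %| \sum_(G <- fs) G x)]
  else (exists b, forall x, F x = b) \/ (exists i, forall x, F x = tnth x i).

Lemma eq_modtree (n m W l : nat) (F F' : n.-tuple bool -> bool) :
  F =1 F' -> modtree m W l F -> modtree m W l F'.
Proof.
move=> eqF; case: l => [|l] /=.
  by case=> -[b Fb]; [left|right]; exists b => x; rewrite -eqF.
by case=> q [fs [qm le_fs fsP FE]]; exists q, fs; split=> // x; rewrite -eqF.
Qed.

Lemma modtree_mono (n m W W' l : nat) (F : n.-tuple bool -> bool) :
  W <= W' -> modtree m W l F -> modtree m W' l F.
Proof.
move=> leW; elim: l F => //= l IHl F [q [fs [qm le_fs fsP FE]]].
exists q, fs; split=> // [|G /fsP /IHl //]; exact: leq_trans leW.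
Qed.

Lemma modtree_const (n m W l p : nat) (b : bool) :
  1 < p -> p %| m -> 0 < W -> @modtree n m W l (fun=> b).
Proof.
move=> p_gt1 pm W_gt0; elim: l b => [|l IHl] b; first by left; exists b.
case: b; first by exists p, [::]; split=> // x; rewrite big_nil dvdn0.
exists p, [:: finfun (fun=> true)]; split=> // [G|x].
  by rewrite inE => /eqP->; apply: eq_modtree (IHl true) => x; rewrite ffunE.
by rewrite big_seq1 ffunE dvdn1; case: eqP p_gt1 => // ->.
Qed.

(* [g] is, modulo [k], a sum of [V] trees: feeding these to one [MOD_k] gate tests
   whether [k] divides [g]. *)
Definition modsum (n m W l k V : nat) (g : n.-tuple bool -> nat) : Prop :=
  exists fs : seq {ffun n.-tuple bool -> bool},
    [/\ size fs <= V, (forall G, G \in fs -> modtree m W l G) &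
        forall x, g x = \sum_(G <- fs) G x %[mod k]].

Section ModSum.

Variables (n m l : nat).
Implicit Types (W k V : nat) (F : n.-tuple bool -> bool) (g h : n.-tuple bool -> nat).

Lemma eq_modsum W k V g h : (forall x, h x = g x %[mod k]) ->
  modsum m W l k V g -> modsum m W l k V h.
Proof. by move=> e [fs [? ? gE]]; exists fs; split=> // x; rewrite e. Qed.

Lemma modsum_mono W W' k V V' g : W <= W' -> V <= V' ->
  modsum m W l k V g -> modsum m W' l k V' g.
Proof.
move=> leW leV [fs [? fsP gE]]; exists fs.
by split=> // [|G /fsP]; [apply: leq_trans leV|apply: modtree_mono].
Qed.

Lemma modsum_bool W k F : modtree m W l F -> modsum m W l k 1 F.
Proof.
move=> Ft; exists [:: finfun F]; split=> // [G|x]; last by rewrite big_seq1 ffunE.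
by rewrite inE => /eqP->; apply: eq_modtree Ft => x; rewrite ffunE.
Qed.

Lemma modsum0 W k V : modsum m W l k V (fun _ : n.-tuple bool => 0).
Proof. by exists [::]; split=> // x; rewrite big_nil. Qed.

Lemma modsumD W k V1 V2 g h : modsum m W l k V1 g -> modsum m W l k V2 h ->
  modsum m W l k (V1 + V2) (fun x => g x + h x).
Proof.
move=> [fs [le_fs fsP gE]] [fs' [le_fs' fsP' hE]]; exists (fs ++ fs').
split=> [|G|x]; first by rewrite size_cat leq_add.
  by rewrite mem_cat => /orP[/fsP|/fsP'].
by rewrite big_cat /= -modnDm gE hE modnDm.
Qed.

Lemma modsum_sum W k V (I : eqType) (r : seq I) (g : I -> n.-tuple bool -> nat) :
  (forall i, i \in r -> modsum m W l k V (g i)) ->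
  modsum m W l k (size r * V) (fun x => \sum_(i <- r) g i x).
Proof.
elim: r => [|i r IHr] gP.
  by apply: eq_modsum (modsum0 _ _ _) => x; rewrite big_nil.
rewrite mulSn; apply: eq_modsum (modsumD (gP i (mem_head _ _)) (IHr _)) => [x|j jr].
  by rewrite big_cons.
by apply: gP; rewrite inE jr orbT.
Qed.

Lemma modsumM W k V c g : modsum m W l k V g ->
  modsum m W l k (c * V) (fun x => c * g x).
Proof.
move=> gP; rewrite -[c in c * V](size_iota 0).
apply: eq_modsum (@modsum_sum _ _ _ _ _ (fun=> g) (fun=> fun=> gP)) => x.
by rewrite big_const_seq count_predT size_iota iter_addn_0 mulnC.
Qed.

(** With c = m / q this lifts a sum known modulo q to one known modulo m, ready to be added to those
    of the other primes. *)
Lemma modsum_dvd W k V c g : 0 < c -> modsum m W l k V g ->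
  modsum m W l (c * k) (c * V) (fun x => c * g x).
Proof.
move=> c_gt0 [fs [le_fs fsP gE]].
have: modsum m W l (c * k) V (fun x => \sum_(G <- fs) G x) by exists fs; split.
by move/(modsumM c); apply: eq_modsum => x; rewrite -!muln_modr gE.
Qed.

Lemma modsum_const W k c p :
  1 < p -> p %| m -> 0 < W -> modsum m W l k c (fun _ : n.-tuple bool => c).
Proof.
move=> p_gt1 pm W_gt0.
have := modsumM c (modsum_bool k (modtree_const n l true p_gt1 pm W_gt0)).
by rewrite !muln1.
Qed.

Lemma modtree_dvd W k V g : k %| m -> V <= W -> modsum m W l k V g ->
  modtree m W l.+1 (fun x => k %| g x).
Proof.
move=> km leVW [fs [le_fs fsP gE]]; exists k, fs.
by split=> // [|x]; [apply: leq_trans leVW|rewrite /dvdn gE].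
Qed.

End ModSum.

(** Scaling each [g q] by m / q and adding them feeds a single MOD_m gate, so a conjunction across
    different primes costs only one level. *)
Lemma modtree_all_dvd (n m W l V : nat) (ps : seq nat) (g : nat -> n.-tuple bool -> nat) :
  all prime ps -> uniq ps -> m = \prod_(q <- ps) q ->
  (forall q, q \in ps -> modsum m W l q V (g q)) ->
  modtree m (W + size ps * (m * V)) l.+1 (fun x => all (fun q => q %| g q x) ps).
Proof.
move=> ps_pr ps_uniq mE gP.
have m_gt0 : 0 < m by rewrite mE big_seq prodn_cond_gt0 // => i /(allP ps_pr)/prime_gt0.
have qm q : q \in ps -> q %| m by move=> q_ps; rewrite mE (big_rem q) ?dvdn_mulr.
apply: eq_modtree (fun x => dvdn_crt_sum (fun q => g q x) ps_pr ps_uniq) _.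
rewrite -mE; apply: (modtree_dvd (V := size ps * (m * V))) => //; first exact: leq_addl.
apply: modsum_sum => q q_ps; apply: modsum_mono (leq_addr _ _) (leqnn _) _.
have mq_gt0 : 0 < m %/ q by rewrite divn_gt0 ?prime_gt0 ?(allP ps_pr) // dvdn_leq ?qm.
have := modsum_dvd mq_gt0 (gP q q_ps); rewrite divnK ?qm //.
by apply: modsum_mono => //; rewrite leq_mul // leq_div.
Qed.

(** * Conjunctions *)

(* The vectors [a] with [a . (1 - y) = 0] and those with [a . (1 - y) = 1] are
   equinumerous, by a translation, as soon as [1 - y] has a nonzero entry. *)
Lemma and_character_sum (p q : nat) (I : finType) (y : I -> bool) :
  prime p -> 0 < q ->
  \sum_(a : {ffun I -> 'F_p}) (p %| \sum_i a i * (1 + p.-1 * y i)) +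
    q.-1 * \sum_(a : {ffun I -> 'F_p}) (p %| \sum_i a i * (1 + p.-1 * y i) + p.-1)
  = p ^ #|I| * [forall i, y i] %[mod q].
Proof.
move=> p_pr q_gt0.
(* Over natural numbers p - 1 plays the role of -1: [1 + p.-1 * y i] stands for 1 - y, which keeps
   just the false entries, and adding [p.-1] tests for the value 1. *)
pose dot (a : {ffun I -> 'F_p}) : 'F_p := (\sum_(i | ~~ y i) a i)%R.
have pB1 : (p.-1%:R = - 1 :> 'F_p)%R.
  by apply/eqP; rewrite -subr_eq0 opprK natr1 prednK ?prime_gt0 // pchar_Fp_0.
have dotE (a : {ffun I -> 'F_p}) : ((\sum_i a i * (1 + p.-1 * y i))%N%:R = dot a)%R.
  rewrite natr_sum /dot [RHS]big_mkcond; apply: eq_bigr => i _.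
  rewrite natrM natrD natrM pB1 natr_Zp; case: (y i) => /=.
    by rewrite mulr1 subrr mulr0.
  by rewrite mulr0 addr0 mulr1.
have dvd0 (a : {ffun I -> 'F_p}) : (p %| \sum_i a i * (1 + p.-1 * y i)) = (dot a == 0)%R.
  by rewrite (dvdn_pcharf (pchar_Fp p_pr)) dotE.
have dvd1 (a : {ffun I -> 'F_p}) :
    (p %| \sum_i a i * (1 + p.-1 * y i) + p.-1) = (dot a == 1)%R.
  by rewrite (dvdn_pcharf (pchar_Fp p_pr)) natrD dotE pB1 subr_eq0.
under eq_bigr do rewrite dvd0.
under [X in _ + _ * X]eq_bigr do rewrite dvd1.
have [/forallP y_all|] := boolP [forall i, y i].
  have dot0 a : dot a = 0%R by rewrite /dot big1 // => i; rewrite y_all.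
  under eq_bigr do rewrite dot0 eqxx.
  rewrite [X in _ + _ * X]big1 => [|a _]; last by rewrite dot0 eq_sym oner_eq0.
  by rewrite muln0 addn0 sum1_card card_ffun card_Fp // muln1.
rewrite negb_forall => /existsP[i0 y_i0]; rewrite muln0.
pose e := [ffun i => (i == i0)%:R]%R : {ffun I -> 'F_p}.
have dotD a : (dot (a + e) = dot a + 1)%R.
  rewrite /dot; under eq_bigr do rewrite ffunE; rewrite big_split /=; congr (_ + _)%R.
  rewrite (bigD1 i0) //= ffunE eqxx big1 ?addr0 // => i /andP[_ /negbTE ne].
  by rewrite ffunE ne.
rewrite [X in _ + _ * X](reindex_inj (addIr e)) /=.
under [X in _ + _ * X]eq_bigr do rewrite dotD -[X in _ == X]add0r (inj_eq (addIr _)).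
(* Both sums now agree, and 1 + (q - 1) copies of the same number vanish modulo q. *)
by rewrite -mulSn prednK // modnMr mod0n.
Qed.

Lemma modsum_sum_cond (n m W l k V : nat) (I : finType) (P : pred I)
    (g : I -> n.-tuple bool -> nat) :
  (forall i, P i -> modsum m W l k V (g i)) ->
  modsum m W l k (#|P| * V) (fun x => \sum_(i | P i) g i x).
Proof.
move=> gP; rewrite cardE; apply: eq_modsum (modsum_sum (g := g) _) => [x|i].
  by rewrite big_enum.
by rewrite mem_enum => /gP.
Qed.

(** The character sum yields p^|I| times the conjunction modulo q, and this factor is inverted. Each
    vector a costs two MOD_p gates, the second with weight q - 1. *)
Lemma modsum_and (n m W W' l V p q : nat) (I : finType)
    (y : I -> n.-tuple bool -> bool) :
  prime p -> prime q -> p != q -> p %| m ->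
  (forall i, modsum m W l p V (y i)) ->
  0 < W -> W <= W' -> #|I| * (p * (1 + p * V)) + p <= W' ->
  modsum m W' l.+1 q (q * (q.+1 * p ^ #|I|)) (fun x => [forall i, y i x]).
Proof.
move=> p_pr q_pr ne_pq pm yP W_gt0 leW le_W'.
have p_gt1 := prime_gt1 p_pr.
have dotP (a : {ffun I -> 'F_p}) c : c <= p ->
    modtree m W' l.+1 (fun x => p %| \sum_i a i * (1 + p.-1 * y i x) + c).
  move=> le_c; apply: (modtree_dvd (V := #|I| * (p * (1 + p * V)) + p)) => //.
  apply: (modsum_mono leW (leqnn _)); apply: modsumD; last first.
    by apply: modsum_mono (leqnn _) le_c _; apply: modsum_const p_gt1 pm W_gt0.
  apply: modsum_sum_cond => i _.
  have le_a : a i <= p by rewrite ltnW // -[p in _ < p](Fp_cast p_pr) ltn_ord.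
  apply: modsum_mono (leqnn _) (leq_mul le_a (leqnn _)) _; apply: modsumM.
  apply: modsumD; first exact: modsum_const p_gt1 pm W_gt0.
  apply: modsum_mono (leqnn _) (leq_mul (leq_pred p) (leqnn V)) _.
  exact: modsumM (yP i).
(* The inverse exists because p and q are distinct primes. *)
pose u : nat := (((p ^ #|I|)%:R : 'F_q)^-1)%R.
have u_le : u <= q by rewrite ltnW // -[q in _ < q](Fp_cast q_pr) ltn_ord.
have uE : u * p ^ #|I| = 1 %[mod q].
  have/(congr1 (@nat_of_ord _)): ((u * p ^ #|I|)%:R = 1%:R :> 'F_q)%R.
    rewrite natrM natr_Zp mulVf //.
    by rewrite -(dvdn_pcharf (pchar_Fp q_pr)) Euclid_dvdX // dvdn_prime2 //
      eq_sym (negbTE ne_pq).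
  by rewrite !val_Fp_nat.
have := modsumM u (modsumD
  (modsum_sum_cond (P := xpredT) (fun a _ => modsum_bool q (dotP a 0 (leq0n _))))
  (modsumM q.-1 (modsum_sum_cond (P := xpredT)
    (fun a _ => modsum_bool q (dotP a p.-1 (leq_pred _)))))).
rewrite !muln1 card_ffun card_Fp // => sumP.
apply: (eq_modsum _ (modsum_mono (leqnn _) _ sumP)) => [x|]; last first.
  by rewrite leq_mul // -mulSn leq_mul // ltnS leq_pred.
under eq_bigr do rewrite addn0.
by rewrite -modnMmr and_character_sum ?prime_gt0 // modnMmr mulnA -modnMml uE modnMml mul1n.
Qed.

(** * Counting ones *)

Lemma leq_expl (a b k : nat) : a <= b -> a ^ k <= b ^ k.
Proof. by case: k => // k le_ab; rewrite leq_exp2r. Qed.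

Lemma leq_bin_exp (n k : nat) : 'C(n, k) <= n ^ k.
Proof.
apply: leq_trans (_ : n ^_ k <= _).
  by rewrite -bin_ffact leq_pmulr ?fact_gt0.
elim: k => // k IHk; rewrite ffactnSr expnSr leq_mul ?leq_subr //.
Qed.

(** A k-subset of the satisfying positions is a k-set of positions on which a monomial is 1. Each
    monomial is a conjunction over a type of exactly k elements, the shape whose cost [modsum_and]
    controls. *)
Lemma bin_count_sum (T : Type) (a : pred T) (s : seq T) (k : nat) :
  'C(count a s, k) = \sum_(S : {set 'I_(size s)} | #|S| == k)
     [forall i : {i | i \in S}, a (tnth (in_tuple s) (val i))].
Proof.
pose B := [set i | a (tnth (in_tuple s) i)].
have -> : count a s = #|B|.
  rewrite -sum1_card -sum1_count (big_tnth _ _ s).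
  by apply: eq_bigl => i; rewrite inE.
rewrite -cards_draws -sum1_card big_mkcond [RHS]big_mkcond /=.
apply: eq_bigr => S _; rewrite inE andbC; case: (#|S| == k) => //=.
suff -> : (S \subset B) = [forall i : {i | i \in S}, a (tnth (in_tuple s) (val i))].
  by case: [forall _, _].
apply/fintype.subsetP/forallP => [SB [i Si]|aS i Si]; first by have := SB i Si; rewrite inE.
by rewrite inE (aS (exist _ i Si)).
Qed.

(** The residue indicator expands into q^e binomials, each into at most (n+1)^(q^e) monomials, each
    of which becomes a sum of MOD_p gates on the bits. *)
Lemma modsum_count_mod (n m p q e c : nat) (s : seq 'I_n) :
  prime p -> prime q -> p != q -> p %| m -> size s <= n ->
  modsum m (q ^ e * (p * (1 + p)) + p) 1 q
    (q ^ e * (q * (n.+1 ^ (q ^ e) * (q * (q.+1 * p ^ (q ^ e))))))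
    (fun x => count (tnth x) s == c %[mod q ^ e]).
Proof.
move=> p_pr q_pr ne_pq pm le_s.
apply: eq_modsum => [x|]; first by rewrite -indicator_modX_bin.
rewrite -[X in X * (q * _)]card_ord.
apply: (modsum_sum_cond (P := xpredT)) => j _.
have le_c : 'C((q ^ e).-1 - c %% q ^ e, (q ^ e).-1 - j) %% q <= q.
  by rewrite ltnW // ltn_pmod ?prime_gt0.
apply: modsum_mono (leqnn _) (leq_mul le_c (leqnn _)) _; apply: modsumM.
apply: eq_modsum => [x|]; first by rewrite bin_count_sum.
(* The base n + 1 is positive even for n = 0, so the exponent may be raised from j to q^e. *)
have le_card : #|[set S : {set 'I_(size s)} | #|S| == j]| <= n.+1 ^ (q ^ e).
  rewrite card_draws card_ord (leq_trans (leq_bin_exp _ _)) //.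
  apply: leq_trans (leq_pexp2l _ (ltnW (ltn_ord j))) => //.
  exact/leq_expl/leqW.
rewrite cardsE in le_card.
apply: modsum_mono (leqnn _) (leq_mul le_card (leqnn _)) _.
apply: modsum_sum_cond => S /eqP card_S.
have cS : #|{: {i | i \in S}}| = j by rewrite card_sig card_S.
apply: modsum_mono (leqnn _) _ (@modsum_and n m 1 _ 0 1 p q _
  (fun i x => tnth x (tnth (in_tuple s) (val i))) p_pr q_pr ne_pq pm _ _ _ _) => //.
- by rewrite cS !leq_mul // leq_pexp2l ?prime_gt0 // ltnW.
- by move=> i; apply: modsum_bool; right; exists (tnth (in_tuple s) (val i)).
- by rewrite addn_gt0 (prime_gt0 p_pr) ?orbT.
- by rewrite cS leq_add2r muln1 leq_mul // ltnW.
Qed.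

Lemma leqM_pow (X a b i j : nat) : a <= X ^ i -> b <= X ^ j -> a * b <= X ^ (i + j).
Proof. by rewrite expnD; apply: leq_mul. Qed.

Lemma leqD_pow (X a b i : nat) : 1 < X -> a <= X ^ i -> b <= X ^ i -> a + b <= X ^ i.+1.
Proof.
move=> X_gt1 le_a le_b; apply: leq_trans (leq_add le_a le_b) _.
by rewrite addnn -mul2n expnS leq_mul.
Qed.

(** Supplies the auxiliary prime through which conjunctions modulo q are routed; this uses that
    there are two primes. *)
Lemma exists_other (ps : seq nat) (q : nat) :
  uniq ps -> 2 <= size ps -> exists2 p, p \in ps & p != q.
Proof.
case: ps => [|a [|b ps]] //= /andP[]; rewrite inE negb_or => /andP[ne_ab _] _ _.
have [eq_aq|ne_aq] := eqVneq a q; last by exists a; rewrite ?mem_head.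
by exists b; [rewrite !inE eqxx orbT | rewrite -eq_aq eq_sym].
Qed.

(** The tested number is 1 - b modulo q, so one gate recovers a 0/1 value that is known only modulo
    q. *)
Lemma dvdn_indicator (q : nat) (b : bool) : 1 < q -> (q %| 1 + q.-1 * b) = b.
Proof.
move=> q_gt1; case: b; last by rewrite muln0 addn0 dvdn1; case: eqP q_gt1 => // ->.
by rewrite muln1 add1n prednK ?dvdnn // ltnW.
Qed.

(* Each [p ^ e] is chosen in ]t, p t]: a residue modulo [p ^ e] is a polynomial of
   degree O(t) over F_p, and a single [MOD_m] gate combines the primes by CRT. *)
Lemma modtree_count_base (m : nat) (ps : seq nat) :
  all prime ps -> uniq ps -> 2 <= size ps -> m = \prod_(q <- ps) q ->
  exists C, forall n t c (s : seq 'I_n),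
    0 < t -> size s <= t ^ size ps -> size s <= n ->
    modtree m (((n + m + 2) ^ t) ^ C) 2 (fun x => count (tnth x) s == c).
Proof.
move=> ps_pr ps_uniq ps_gt1 mE.
have pr q : q \in ps -> prime q by apply: (allP ps_pr).
have m_gt0 : 0 < m by rewrite mE big_seq prodn_cond_gt0 // => i /pr/prime_gt0.
have qm q : q \in ps -> q %| m by move=> q_ps; rewrite mE (big_rem q) ?dvdn_mulr.
(* The summands of [a] bound, in order, the factors in [modsum_count_mod] by powers of X: q^e, q,
   (n+1)^(q^e), q, q+1, p^(q^e). *)
pose r := size ps; pose a := 2 + (1 + (m + (1 + (1 + m)))).
exists (r + (1 + a.+2)).+1 => n t c s t_gt0 le_s le_sn.
have B_gt0 : 0 < n + m + 2 by rewrite addn2.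
set X := (n + m + 2) ^ t.
have le_X k : k <= n + m + 2 -> k <= X.
  by move/leq_trans; apply; rewrite -{1}[n + m + 2]expn1 leq_pexp2l.
have X_gt1 : 1 < X by apply: le_X; lia.
have X_gt0 := ltnW X_gt1.
have le_XX i j : i <= j -> X ^ i <= X ^ j by apply: leq_pexp2l.
have le_tX : t <= X.
  by apply: leq_trans (ltnW (ltn_expl t (ltnSn 1))) _; apply: leq_expl; lia.
(* A value c beyond the length is never attained; otherwise c lies below the product of the prime
   powers, as remaindering requires. *)
have [gt_c|le_c] := ltnP (size s) c.
  apply: (@eq_modtree _ _ _ _ (fun=> false)) => [x|].
    by have := count_size (tnth x) s; case: eqP => // ->; lia.
  have q_ps : head 0 ps \in ps by rewrite -nth0 mem_nth // ltnW.
  by apply: modtree_const (prime_gt1 (pr _ q_ps)) (qm _ q_ps) _; rewrite expn_gt0 X_gt0.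
pose e q := (trunc_log q t).+1.
have eP q : q \in ps -> t < q ^ e q <= q * t.
  move=> q_ps; have /andP[le_t lt_t] := trunc_log_bounds (prime_gt1 (pr _ q_ps)) t_gt0.
  by rewrite lt_t expnS leq_pmul2l ?prime_gt0 ?pr.
have lt_prod : t ^ size ps < \prod_(q <- ps) q ^ e q.
  apply: ltn_expn_prod; first by case: (ps) ps_gt1.
  by move=> q /eP/andP[].
pose g q (x : n.-tuple bool) : nat := 1 + q.-1 * (count (tnth x) s == c %[mod q ^ e q]).
have gP q : q \in ps -> modsum m (X ^ 5) 1 q (X ^ a.+2) (g q).
  move=> q_ps; have [p p_ps ne_pq] := exists_other q ps_uniq ps_gt1.
  have [q_pr p_pr] := (pr _ q_ps, pr _ p_ps).
  have [le_q le_p] : q <= m /\ p <= m by split; apply: dvdn_leq (qm _ _).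
  have le_K : q ^ e q <= m * t.
    by have /andP[_ /leq_trans] := eP q q_ps; apply; rewrite leq_mul.
  have le_expK k : 0 < k -> k <= n + m + 2 -> k ^ (q ^ e q) <= X ^ m.
    move=> k_gt0 le_k; rewrite -expnM mulnC.
    exact: leq_trans (leq_pexp2l k_gt0 le_K) (leq_expl _ le_k).
  have [qX pX] : q <= X ^ 1 /\ p <= X ^ 1 by rewrite !expn1; split; apply: le_X; lia.
  have [qX' pX'] : q.+1 <= X ^ 1 /\ 1 + p <= X ^ 1.
    by rewrite !expn1; split; apply: le_X; lia.
  have KX : q ^ e q <= X ^ 2.
    apply: leq_trans le_K _; rewrite -mulnn leq_mul //; apply: le_X; lia.
  have sP := modsum_count_mod (e q) c p_pr q_pr ne_pq (qm _ p_ps) le_sn.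
  have W_gt0 : 0 < q ^ e q * (p * (1 + p)) + p by rewrite addn_gt0 (prime_gt0 p_pr) orbT.
  have oneP := @modsum_const n m 1 _ q 1 p (prime_gt1 p_pr) (qm _ p_ps) W_gt0.
  apply: modsum_mono (modsumD oneP (modsumM q.-1 sP)).
    apply: leqD_pow => //; last by apply: leq_trans pX _; apply: le_XX.
    exact: (leqM_pow KX (leqM_pow pX pX')).
  apply: leqD_pow => //; first by rewrite expn_gt0 X_gt0.
  apply: (leqM_pow (i := 1) (leq_trans (leq_pred _) qX)).
  apply: leqM_pow KX (leqM_pow qX (leqM_pow _ (leqM_pow qX (leqM_pow qX' _)))).
    by apply: le_expK => //; lia.
  by apply: le_expK; rewrite ?prime_gt0 //; lia.
apply: eq_modtree (modtree_mono _ (modtree_all_dvd ps_pr ps_uniq mE gP)) => [x|].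
  rewrite -(@eq_of_prime_powers ps e) //; last 2 first.
  - exact: leq_ltn_trans (leq_trans (count_size _ _) le_s) lt_prod.
  - exact: leq_ltn_trans (leq_trans le_c le_s) lt_prod.
  by apply: eq_in_all => q /pr/prime_gt1 q_gt1; rewrite /g dvdn_indicator.
apply: leqD_pow => //; first by apply: le_XX; rewrite /a; lia.
apply: leqM_pow; first exact: ltnW (ltn_expl _ X_gt1).
by apply: leqM_pow; rewrite ?expn1 ?le_X //; lia.
Qed.

(** * Multiplying the block length by guessing counts *)

Lemma sum_count_blocks (T : Type) (a : pred T) (s : seq T) (t k : nat) :
  size s <= t * k -> \sum_(b < t) count a (take k (drop (b * k) s)) = count a s.
Proof.
elim: t s => [|t IHt] s le_s.
  by rewrite big_ord0; case: s le_s.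
rewrite big_ord_recl drop0 -[in RHS](cat_take_drop k s) count_cat; congr (_ + _).
rewrite -IHt; last by rewrite size_drop; lia.
by apply: eq_bigr => b _; rewrite drop_drop /bump /= mulSn addnC.
Qed.

(** Only the guess [g0] of the true counts contributes, and the filter on totals keeps it precisely
    when the true total is c. *)
Lemma sum_guess_count (n t c : nat) (k : 'I_t -> nat) :
  (forall b, k b <= n) ->
  \sum_(g : {ffun 'I_t -> 'I_n.+1} | \sum_b g b == c) [forall b, k b == g b]
    = (\sum_b k b == c).
Proof.
move=> le_k; pose g0 := [ffun b => inord (k b)] : {ffun 'I_t -> 'I_n.+1}.
have g0E b : g0 b = k b :> nat by rewrite ffunE inordK // ltnS.
have guessE (g : {ffun 'I_t -> 'I_n.+1}) : [forall b, k b == g b] = (g == g0).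
  apply/forallP/eqP => [eq_kg|-> b]; last by rewrite g0E.
  by apply/ffunP => b; apply/val_inj; rewrite /= g0E (eqP (eq_kg b)).
rewrite (eq_bigr (fun g => (g == g0) : nat)) => [|g _]; last by rewrite guessE.
rewrite big_mkcond (bigD1 g0) //= eqxx [X in _ + X = _]big1; last first.
  by move=> g ne_g; rewrite (negbTE ne_g); case: ifP.
by rewrite addn0 (eq_bigr k) => [|b _ //]; case: (_ == c).
Qed.

(* Guess the counts of [t] blocks: exactly one guess is correct, so the sum of the
   conjunctions over all guesses is again 0 or 1. *)
Lemma modsum_count_step (n m t l C T : nat) (ps : seq nat) :
  all prime ps -> uniq ps -> 2 <= size ps -> m = \prod_(q <- ps) q -> 0 < t ->
  let X := (n + m + 2) ^ t in
  (forall q c (s : seq 'I_n), q \in ps -> size s <= T -> size s <= n ->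
    modsum m (X ^ C) l q (X ^ C) (fun x => count (tnth x) s == c)) ->
  forall q c (s : seq 'I_n), q \in ps -> size s <= t * T -> size s <= n ->
    modsum m (X ^ (C + 5)) l.+1 q (X ^ (C + 5)) (fun x => count (tnth x) s == c).
Proof.
move=> ps_pr ps_uniq ps_gt1 mE t_gt0 X IH q c s q_ps le_s le_sn.
have pr p : p \in ps -> prime p by apply: (allP ps_pr).
have m_gt0 : 0 < m by rewrite mE big_seq prodn_cond_gt0 // => i /pr/prime_gt0.
have qm p : p \in ps -> p %| m by move=> p_ps; rewrite mE (big_rem p) ?dvdn_mulr.
have le_X k : k <= n + m + 2 -> k <= X ^ 1.
  rewrite expn1; move/leq_trans; apply; rewrite -{1}[n + m + 2]expn1 leq_pexp2l //; lia.
have X_gt1 : 1 < X by rewrite -[X]expn1; apply: le_X; lia.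
have X_gt0 := ltnW X_gt1.
have le_XX i j : i <= j -> X ^ i <= X ^ j by apply: leq_pexp2l.
have le_tX : t <= X ^ 1.
  by rewrite expn1; apply: leq_trans (ltnW (ltn_expl t (ltnSn 1))) _; apply: leq_expl; lia.
(* The block tests are needed modulo another prime p, which is why the hypothesis ranges over all
   primes of [ps]. *)
have [p p_ps ne_pq] := exists_other q ps_uniq ps_gt1.
have [q_pr p_pr] := (pr _ q_ps, pr _ p_ps).
have [le_q le_p] : q <= m /\ p <= m by split; apply: dvdn_leq (qm _ _).
have pX : p <= X ^ 1 by apply: le_X; lia.
pose block b := take T (drop (b * T) s).
have size_block b : size (block b) <= T /\ size (block b) <= n.
  rewrite /block size_take_min size_drop; lia.
apply: eq_modsum => [x|].
  rewrite -(sum_count_blocks (tnth x) le_s) -(@sum_guess_count n) //.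
  by move=> b; apply: leq_trans (count_size _ _) (size_block b).2.
have le_guess : #|[pred g : {ffun 'I_t -> 'I_n.+1} | \sum_b g b == c]| <= X ^ 1.
  apply: leq_trans (max_card _) _; rewrite card_ffun !card_ord expn1.
  by apply: leq_expl; lia.
(* Four factors, each at most X: the guesses, q, q + 1 and p^t. The number of summands of the
   previous level enters only the fan-in. *)
apply: (@modsum_mono _ _ _ _ _ _ (X ^ (1 + (1 + (1 + 1)))) _ _ (leqnn _)).
  by apply: le_XX; lia.
rewrite [X ^ (1 + (_ + _))]expnD.
apply: modsum_mono (leqnn _) (leq_mul le_guess (leqnn _)) _.
apply: modsum_sum_cond => g _.
have := @modsum_and n m (X ^ C) (X ^ (C + 5)) l (X ^ C) p q _
  (fun (b : 'I_t) x => count (tnth x) (block b) == g b) p_pr q_pr ne_pq (qm _ p_ps).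
rewrite card_ord => /(_ (fun b => IH _ _ _ p_ps (size_block b).1 (size_block b).2)).
rewrite expn_gt0 X_gt0 le_XX ?leq_addr //= => andP.
apply: modsum_mono (leqnn _) _ (andP isT isT _).
  apply: leqM_pow; first by apply: le_X; lia.
  apply: leqM_pow; first by apply: le_X; lia.
  by rewrite expn1; apply: leq_expl; lia.
have -> : C + 5 = (1 + (1 + (1 + C).+1)).+1 by lia.
apply: leqD_pow => //; last first.
  by apply: leq_trans pX _; apply: le_XX.
apply: leqM_pow le_tX (leqM_pow pX _).
apply: leqD_pow => //; first by rewrite expn_gt0 X_gt0.
exact: leqM_pow pX (leqnn _).
Qed.

(** Each of the k guessing levels multiplies the length by t and adds 5 to the exponent, so [C] is
    uniform in n and t. *)
Lemma modsum_count (m k : nat) (ps : seq nat) :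
  all prime ps -> uniq ps -> 2 <= size ps -> m = \prod_(q <- ps) q ->
  exists C, forall n t q c (s : seq 'I_n), 0 < t -> q \in ps ->
    size s <= t ^ (size ps + k) -> size s <= n ->
    let X := (n + m + 2) ^ t in
    modsum m (X ^ C) k.+2 q (X ^ C) (fun x => count (tnth x) s == c).
Proof.
move=> ps_pr ps_uniq ps_gt1 mE; elim: k => [|k [C CP]].
  have [C CP] := modtree_count_base ps_pr ps_uniq ps_gt1 mE.
  exists C => n t q c s t_gt0 q_ps; rewrite addn0 => le_s le_sn X.
  apply: modsum_mono (leqnn _) _ (modsum_bool q (CP n t c s t_gt0 le_s le_sn)).
  by rewrite !expn_gt0 addn2.
exists (C + 5) => n t q c s t_gt0 q_ps; rewrite addnS expnS => le_s le_sn X.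
apply: (@modsum_count_step n m t _ C (t ^ (size ps + k)) ps) => //.
by move=> p b s' p_ps le_s' le_sn'; apply: CP.
Qed.

(** A symmetric f is the sum of the tests N = c over the weights c that it accepts; one output gate
    turns this sum into a tree. *)
Lemma modtree_symmetric (m k : nat) (ps : seq nat) :
  all prime ps -> uniq ps -> 2 <= size ps -> m = \prod_(q <- ps) q ->
  exists C, forall n t (f : n.-tuple bool -> bool), 0 < t ->
    n <= t ^ (size ps + k) -> symmetric_function f ->
    modtree m (((n + m + 2) ^ t) ^ C) k.+3 f.
Proof.
move=> ps_pr ps_uniq ps_gt1 mE.
have [C CP] := modsum_count k ps_pr ps_uniq ps_gt1 mE.
exists C.+3 => n t f t_gt0 le_n f_sym; set X := _ ^ t.
have pr p : p \in ps -> prime p by apply: (allP ps_pr).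
have m_gt0 : 0 < m by rewrite mE big_seq prodn_cond_gt0 // => i /pr/prime_gt0.
have qm p : p \in ps -> p %| m by move=> p_ps; rewrite mE (big_rem p) ?dvdn_mulr.
have q_ps : head 0 ps \in ps by rewrite -nth0 mem_nth // ltnW.
move: (head 0 ps) q_ps => q q_ps; have q_pr := pr _ q_ps.
have le_q : q <= m by rewrite dvdn_leq ?qm.
have le_X j : j <= n + m + 2 -> j <= X.
  move/leq_trans; apply; rewrite -{1}[n + m + 2]expn1 leq_pexp2l //; lia.
have X_gt1 : 1 < X by apply: le_X; lia.
pose h c := [exists x : n.-tuple bool, f x && (count id x == c)].
have fE x : (\sum_(c < n.+1 | h c) (count (tnth x) (enum 'I_n) == c) : nat) = f x.
  have -> : count (tnth x) (enum 'I_n) = count id x.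
    by rewrite -(map_tnth_enum x) count_map.
  have le_x : count id x < n.+1 by rewrite ltnS -[n in _ <= n](size_tuple x) count_size.
  have hE : h (Ordinal le_x) = f x.
    apply/existsP/idP => [[y /andP[fy /eqP eq_yx]]|fx]; last by exists x; rewrite fx /=.
    by rewrite (f_sym x y).
  rewrite big_mkcond (bigD1 (Ordinal le_x)) //= hE eqxx big1 ?addn0; first by case: (f x).
  move=> c ne_c; case: ifP => // _; apply/eqP; rewrite eqb0.
  by apply: contra ne_c => /eqP eq_c; apply/eqP/val_inj.
have sP : modsum m (X ^ C) k.+2 q (X ^ C.+3)
    (fun x => 1 + q.-1 * \sum_(c < n.+1 | h c) (count (tnth x) (enum 'I_n) == c)).
  have X_gt0 := ltnW X_gt1.
  have oneP := @modsum_const n m k.+2 (X ^ C) q 1 q (prime_gt1 q_pr) (qm _ q_ps).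
  have cP (c : 'I_n.+1) : h c ->
      modsum m (X ^ C) k.+2 q (X ^ C) (fun x => count (tnth x) (enum 'I_n) == c).
    by move=> _; apply: CP; rewrite ?size_enum_ord.
  apply: modsum_mono (leqnn _) _ (modsumD (oneP _) (modsumM q.-1 (modsum_sum_cond cP))).
    apply: (@leqD_pow _ _ _ (1 + (1 + C))) => //; first by rewrite expn_gt0 X_gt0.
    apply: leqM_pow; first by rewrite expn1 le_X //; lia.
    apply: leqM_pow (leqnn _); rewrite expn1.
    by apply: leq_trans (max_card _) _; rewrite card_ord le_X //; lia.
  by rewrite expn_gt0 X_gt0.
apply: (eq_modtree _ (modtree_dvd (V := X ^ C.+3) (qm _ q_ps) (leqnn _)
  (modsum_mono _ (leqnn _) sP))) => [x|].
  by rewrite fE dvdn_indicator // prime_gt1.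
by rewrite leq_pexp2l // ltnW //; lia.
Qed.

(** * From trees to circuits *)

Lemma eq_sum_all (T : Type) (P : pred T) (f g : T -> nat) (s : seq T) :
  all P s -> (forall i, P i -> f i = g i) -> \sum_(i <- s) f i = \sum_(i <- s) g i.
Proof.
move=> sP fg; elim: s sP => [|i s IHs] /=; first by rewrite !big_nil.
by case/andP=> Pi /IHs; rewrite !big_cons fg // => ->.
Qed.

(** Appending gates never alters earlier entries; the abstract [h] covers both gate values and gate
    depths. *)
Lemma foldl_rcons_cat (S T : Type) (h : seq S -> T -> S) (gs new : seq T) :
  exists vs, foldl (fun vs g => rcons vs (h vs g)) [::] (gs ++ new)
    = foldl (fun vs g => rcons vs (h vs g)) [::] gs ++ vs.
Proof.
elim/last_ind: new => [|new g [vs IH]]; first by exists [::]; rewrite !cats0.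
rewrite -rcons_cat foldl_rcons IH; eexists; exact: rcons_cat.
Qed.

Lemma size_foldl_rcons (S T : Type) (h : seq S -> T -> S) (gs : seq T) :
  size (foldl (fun vs g => rcons vs (h vs g)) [::] gs) = size gs.
Proof.
by elim/last_ind: gs => // gs g IH; rewrite foldl_rcons !size_rcons IH.
Qed.

Lemma topological_cat (n k : nat) (gs new : seq (mod_gate n)) :
  topological k (gs ++ new) = topological k gs && topological (k + size gs) new.
Proof.
elim: gs k => [|g gs IH] k /=; first by rewrite addn0.
by rewrite IH addSnnS andbA.
Qed.

Lemma wire_val_cat (n : nat) (x : n.-tuple bool) (gs new : seq (mod_gate n)) (w : wire n) :
  wire_before (size gs) w ->
  wire_val x (gate_vals x (gs ++ new)) w = wire_val x (gate_vals x gs) w.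
Proof.
case: w => //= j lt_j; have [vs] := foldl_rcons_cat (gate_val x) gs new.
by rewrite -!/(gate_vals x _) => ->; rewrite nth_cat size_foldl_rcons lt_j.
Qed.

Lemma wire_depth_cat (n : nat) (gs new : seq (mod_gate n)) (w : wire n) :
  wire_before (size gs) w ->
  wire_depth (gate_depths (gs ++ new)) w = wire_depth (gate_depths gs) w.
Proof.
case: w => //= j lt_j.
have [ds] := foldl_rcons_cat
  (fun ds (g : mod_gate n) => (\max_(w <- fanin g) wire_depth ds w).+1) gs new.
by rewrite -!/(gate_depths _) => ->; rewrite nth_cat size_foldl_rcons lt_j.
Qed.

Lemma wire_before_leq (n j k : nat) (w : wire n) :
  j <= k -> wire_before j w -> wire_before k w.
Proof. by case: w => //= i le_jk /leq_trans; apply. Qed.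

Definition valid_gates (n m D : nat) (gs : seq (mod_gate n)) : bool :=
  [&& topological 0 gs, all (fun g => modulus g %| m) gs &
      all (fun k => k <= D) (gate_depths gs)].

Definition computed_at (n l : nat) (gs : seq (mod_gate n)) (w : wire n)
    (F : n.-tuple bool -> bool) : Prop :=
  [/\ wire_before (size gs) w, wire_depth (gate_depths gs) w <= l &
      forall x, wire_val x (gate_vals x gs) w = F x].

Lemma valid_gates_rcons (n m D l q : nat) (gs : seq (mod_gate n)) (ws : seq (wire n)) :
  valid_gates m D gs -> q %| m -> l < D ->
  all (wire_before (size gs)) ws ->
  all (fun w => wire_depth (gate_depths gs) w <= l) ws ->
  valid_gates m D (rcons gs (ModGate q ws)) /\
  computed_at l.+1 (rcons gs (ModGate q ws)) (Gate (size gs))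
    (fun x => q %| \sum_(w <- ws) wire_val x (gate_vals x gs) w).
Proof.
case/and3P=> gs_top gs_mod gs_dep qm lt_lD ws_gs ws_dep.
have dE : gate_depths (rcons gs (ModGate q ws))
    = rcons (gate_depths gs) (\max_(w <- ws) wire_depth (gate_depths gs) w).+1.
  by rewrite /gate_depths foldl_rcons.
have le_l : \max_(w <- ws) wire_depth (gate_depths gs) w <= l.
  move: ws_dep; rewrite {dE ws_gs}; elim: ws => [|w ws IH] /=; first by rewrite big_nil.
  by rewrite big_cons geq_max => /andP[-> /IH].
split.
  rewrite /valid_gates dE !all_rcons gs_mod gs_dep qm -cats1 topological_cat gs_top /=.
  by rewrite add0n ws_gs (leq_trans _ lt_lD).
split=> [||x] /=; first by rewrite size_rcons.
  by rewrite dE nth_rcons size_foldl_rcons ltnn eqxx.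
by rewrite /gate_vals foldl_rcons nth_rcons size_foldl_rcons ltnn eqxx.
Qed.

(** The number of internal nodes of the complete W-ary tree of depth l; leaves are wires and cost no
    gate. *)
Definition gates_bound (W l : nat) : nat := iter l (fun N => (W * N).+1) 0.

(** Stated for an arbitrary prefix [gs], so that the subtrees can be laid out one after another. The
    last clause makes the root the final gate, hence the output. *)
Lemma valid_gates_modtree (n m W D l : nat) (F : n.-tuple bool -> bool) :
  l <= D -> modtree m W l F ->
  forall gs, valid_gates m D gs -> exists new w,
    [/\ size new <= gates_bound W l, valid_gates m D (gs ++ new),
        computed_at l (gs ++ new) w F &
        0 < l -> w = Gate (size (gs ++ new)).-1].
Proof.
elim: l F => [|l IHl] F le_lD /=.
  case=> [[b FE]|[i FE]] gs gsP; exists [::]; rewrite cats0.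
    by exists (Const b); split=> //; split=> // x; rewrite FE.
  by exists (Var i); split=> //; split=> // x; rewrite FE.
case=> q [fs [qm le_fs fsP FE]] gs gsP.
have [new [ws [le_new newP ws_new ws_dep wsE]]] : exists new ws,
    [/\ size new <= size fs * gates_bound W l, valid_gates m D (gs ++ new),
        all (wire_before (size (gs ++ new))) ws,
        all (fun w => wire_depth (gate_depths (gs ++ new)) w <= l) ws &
        forall x, \sum_(w <- ws) wire_val x (gate_vals x (gs ++ new)) w
          = \sum_(G <- fs) G x].
  elim: fs fsP {le_fs FE} => [|G fs IHfs] fsP.
    by exists [::], [::]; rewrite cats0; split=> // x; rewrite !big_nil.
  have [|new [ws [le_new newP ws_new ws_dep wsE]]] := IHfs.
    by move=> H H_fs; apply: fsP; rewrite inE H_fs orbT.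
  have [new' [w [le_new' newP' [w_new w_dep wE] _]]] :=
    IHl _ (ltnW le_lD) (fsP G (mem_head _ _)) _ newP.
  exists (new ++ new'), (w :: ws); rewrite catA /= w_new w_dep /=; split=> //.
  - by rewrite size_cat mulSn addnC leq_add.
  - apply: sub_all ws_new => v; apply: wire_before_leq.
    by rewrite [X in _ <= X]size_cat leq_addr.
  - elim: (ws) ws_new ws_dep => //= v s IHs /andP[v_new /IHs{}IHs] /andP[v_dep /IHs->].
    by rewrite wire_depth_cat ?v_dep.
  - move=> x; rewrite !big_cons wE -wsE; congr (_ + _).
    by apply: eq_sum_all ws_new _ => v v_new; rewrite wire_val_cat.
have [newP' [w_new w_dep wE]] := valid_gates_rcons newP qm le_lD ws_new ws_dep.
exists (rcons new (ModGate q ws)), (Gate (size (gs ++ new))).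
rewrite -rcons_cat; split=> //; last by rewrite size_rcons.
  by rewrite size_rcons ltnS (leq_trans le_new) // leq_mul.
by split=> // x; rewrite wE wsE FE.
Qed.

Lemma gates_bound_leq (W l : nat) : gates_bound W l <= W.+1 ^ l.
Proof.
elim: l => //= l IHl; rewrite expnS mulSn -addn1 addnC.
by rewrite leq_add ?expn_gt0 // leq_mul.
Qed.

Lemma circuit_of_modtree (n m W l : nat) (F : n.-tuple bool -> bool) :
  modtree m W l.+1 F -> exists c : circuit n,
    [/\ is_mod_circuit m c, circuit_depth c <= l.+1, computes c F &
        circuit_size c <= W.+1 ^ l.+1].
Proof.
move=> Ft; have [gs [w]] := valid_gates_modtree (leqnn _) Ft
  (isT : @valid_gates n m l.+1 [::]).
rewrite cat0s => -[le_gs /and3P[gs_top gs_mod gs_dep] [w_gs _ wE] /(_ isT) w_last].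
have gs_gt0 : 0 < size gs by case: (gs) w_gs; rewrite w_last.
exists (Circuit gs_gt0 gs_top); split=> //.
- by apply/bigmax_leqP_seq => k k_ds _; apply: (allP gs_dep).
- move=> x; rewrite -wE w_last /= /circuit_eval /= -nth_last.
  by rewrite /gate_vals size_foldl_rcons.
- exact: leq_trans le_gs (gates_bound_leq _ _).
Qed.

(** * Asymptotics *)

Local Open Scope classical_set_scope.
Local Open Scope ring_scope.

(** This fixes t as the integer part of the K-th root plus one, which exceeds the root and is
    positive even at n = 0. *)
Lemma leq_truncn_root (R : realType) (K n : nat) : (0 < K)%N ->
  (n <= (Num.truncn ((n%:R : R) `^ K%:R^-1)).+1 ^ K)%N.
Proof.
move=> K_gt0; rewrite -(ler_nat R) natrX.
have nE : ((n%:R : R) `^ K%:R^-1) ^+ K = n%:R.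
  by rewrite -powR_mulrn ?powR_ge0 // -powRrM mulVf ?pnatr_eq0 -?lt0n // powRr1.
by rewrite -[X in X <= _]nE lerXn2r ?nnegrE ?powR_ge0 ?ler0n // ltW // truncnS_gt.
Qed.

Lemma soft_bigO_root_ln (R : realType) (m E K : nat) :
  soft_bigO (R := R)
    (fun n : nat => ln (n + m + 2)%:R *+ ((Num.truncn ((n%:R : R) `^ K%:R^-1)).+1 * E))
    (fun n : nat => n%:R `^ K%:R^-1).
Proof.
(* One logarithm suffices: t is at most twice the root and ln(n+m+2) at most (m+4) ln n; the
   successor keeps the constant positive. *)
exists 1%N; apply/eqO_exP; exists ((2 * E * (m + 4)).+1)%N%:R => //.
apply: filterS (nbhs_infty_ge 2) => n n_ge2.
have n_ge1 : 1 <= n%:R :> R by rewrite ler1n; apply: leq_trans n_ge2.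
have ln_ge0n : 0 <= ln (n%:R : R) by apply: ln_ge0.
set y := n%:R `^ _; have y_ge1 : 1 <= y.
  have <- : 1 `^ K%:R^-1 = 1 :> R by rewrite powR1.
  by rewrite ge0_ler_powR ?invr_ge0 // nnegrE // (le_trans _ n_ge1).
have le_t : (Num.truncn y).+1%:R <= 2 * y.
  by rewrite -natr1 mulr2n mulrDl mul1r lerD // truncn_le (le_trans _ y_ge1).
(* For n at least 2, n + m + 2 <= n (m+3) <= n 2^(m+3) <= n^(m+4). *)
have le_ln : ln (n + m + 2)%:R <= (m + 4)%:R * ln n%:R :> R.
  rewrite mulr_natl -lnXn ?(lt_le_trans _ n_ge1) //.
  rewrite ler_ln ?posrE ?exprn_gt0 ?(lt_le_trans _ n_ge1) ?ltr0n ?addn2 //.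
  rewrite -natrX ler_nat.
  apply: (@leq_trans (n * (m + 3))); first by nia.
  have -> : (m + 4 = (m + 3).+1)%N by lia.
  rewrite expnS leq_mul // (leq_trans (ltnW (ltn_expl _ (ltnSn 1)))) //.
  exact: leq_expl.
have ln_B_ge0 : 0 <= ln (n + m + 2)%:R :> R by rewrite ln_ge0 // ler1n addn2.
rewrite expr1 -[X in `|X|]mulr_natl natrM !ger0_norm ?mulr_ge0 ?powR_ge0 //.
apply: (@le_trans _ _ (2 * y * E%:R * ((m + 4)%:R * ln n%:R))).
  by rewrite ler_pM ?mulr_ge0 // ler_pM.
have -> : (2 * E * (m + 4)).+1%N%:R = 2 * E%:R * (m + 4)%:R + 1 :> R.
  by rewrite -natr1 !natrM.
rewrite [X in _ <= X]mulrDl mul1r.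
have -> : 2 * y * E%:R * ((m + 4)%:R * ln n%:R)
    = 2 * E%:R * (m + 4)%:R * (y * ln n%:R) by ring.
by rewrite lerDl mulr_ge0 ?powR_ge0.
Qed.

Theorem theorem1p2 (R : realType) (d m r : nat) (ps : seq nat)
    (hd : (3 <= d)%N) (hr : (2 <= r)%N)
    (ps_prime : all prime ps) (ps_uniq : uniq ps) (ps_size : size ps = r)
    (hm : m = (\prod_(p <- ps) p)%N) :
  exists e : nat -> R,
    soft_bigO e (fun n : nat => n%:R `^ ((r + d - 3)%N%:R)^-1) /\
    forall (n : nat) (f : n.-tuple bool -> bool), symmetric_function f ->
      exists c : circuit n,
        [/\ is_mod_circuit m c, (circuit_depth c <= d)%N, computes c f &
            (circuit_size c)%:R <= expR (e n)].
Proof.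
case: d hd => [|[|[|k]]] // _; rewrite -ps_size in hr *.
have [C CP] := modtree_symmetric k ps_prime ps_uniq hr hm.
have -> : (size ps + k.+3 - 3 = size ps + k)%N by lia.
set K := (size ps + k)%N; have K_gt0 : (0 < K)%N by rewrite addn_gt0 ltnW.
(* The exponential of this is X^((C+1)(k+3)) with X = (n+m+2)^t, which bounds (X^C + 1)^(k+3)
   because X^C + 1 <= 2 X^C <= X^(C+1). *)
exists (fun n => ln (n + m + 2)%:R
  *+ ((Num.truncn ((n%:R : R) `^ K%:R^-1)).+1 * (C.+1 * k.+3))).
split=> [|n f f_sym]; first exact: soft_bigO_root_ln.
have := CP n _ f (ltn0Sn _) (leq_truncn_root R n K_gt0) f_sym.
set t := (Num.truncn _).+1; have t_gt0 : (0 < t)%N by [].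
case/circuit_of_modtree=> c [c_mod c_depth c_f c_size]; exists c; split=> //.
have B_gt0 : 0 < (n + m + 2)%:R :> R by rewrite ltr0n addn2.
rewrite -lnXn // lnK ?posrE ?exprn_gt0 // -natrX ler_nat.
apply: leq_trans c_size _; rewrite !expnM; apply: leq_expl.
have X_gt1 : (1 < (n + m + 2) ^ t)%N.
  by have := ltn_exp2r 1 (n + m + 2) t_gt0; rewrite exp1n => ->; lia.
by rewrite expnS -addn1; apply: leq_trans (_ : 2 * ((n + m + 2) ^ t) ^ C <= _)%N;
  [rewrite mul2n -addnn leq_add2l expn_gt0 ltnW | rewrite leq_mul].
Qed.
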